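(* Let $\mathcal{H}$ be a complex Hilbert space and let $x, y, u \in \mathcal{H}$ with $\|u\|=1$. Then for any Orlicz function $\phi$, \[\phi\left(\left|\langle x, u \rangle \langle u, y \rangle \right|\right) \leq \frac{1}{2} \left(\phi\left(\|x\|\|y\|\right) + \phi \left(|\langle x, y \rangle |\right) \right).\] In particular (taking $\phi(t)=\exp(t)-1$ and $\phi(t)=\exp(t^2)-1$), \[\left|\langle x, u \rangle \langle u, y\rangle \right| \leq \log \left(\tfrac12 \exp(\|x\|\|y\|) + \tfrac12 \exp(|\langle x, y \rangle|)\right) \leq \|x\|\|y\|\] and \[\left|\langle x, u \rangle \langle u, y\rangle \right| \leq \sqrt{ \log \left(\tfrac12 \exp(\|x\|^2\|y\|^2) + \tfrac12 \exp(|\langle x, y \rangle|^2)\right)} \leq \|x\|\|y\|.\]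
   Context: An Orlicz function is a continuous, convex, increasing function $\phi:[0,\infty)\to[0,\infty)$ with $\phi(0)=0$, $\phi(t)>0$ for all $t>0$, and $\lim_{t\to\infty}\phi(t)=\infty$. *)

(* Defs.v *)
Set Warnings "-notation-overridden,-notation-incompatible-prefix".
From HB Require Import structures.
From mathcomp Require Export all_boot all_order all_algebra.
From mathcomp Require Export all_classical all_reals all_analysis.
From mathcomp Require Export complex.

Set Implicit Arguments.
Unset Strict Implicit.
Unset Printing Implicit Defensive.

Export Order.TTheory GRing.Theory Num.Theory.
Export numFieldNormedType.Exports.

Local Open Scope classical_set_scope.
Local Open Scope ring_scope.

(* Norms over R[i] take their values in R[i], on the nonnegative real half-line;
   [rnorm v] is the same number read in R.  It is used both for the norm of a
   vector and for the modulus of a scalar. *)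
Definition rnorm (R : rcfType) (V : normedZmodType R[i]) (v : V) : R :=
  complex.Re `|v|.

(* A function [0, +oo[ -> [0, +oo[ is encoded as a function R -> R whose values
   on negative reals are unconstrained.  Monotonicity is stated in the weak
   sense; strict monotonicity on [0, +oo[ follows from convexity, phi 0 = 0 and
   positivity, so the two readings of "increasing" define the same class. *)
Record orlicz_function (R : realType) (phi : R -> R) : Prop := OrliczFunction {
  orlicz_ge0 : forall t, 0 <= t -> 0 <= phi t;
  orlicz_continuous : {within `[0, +oo[, continuous phi};
  orlicz_convex : convex_function (`[0, +oo[ : set R^o) (phi : R^o -> R^o);
  orlicz_increasing : {in `[0, +oo[ &, {homo phi : s t / s <= t}};
  orlicz0 : phi 0 = 0;
  orlicz_gt0 : forall t, 0 < t -> 0 < phi t;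
  orlicz_cvgy : phi t @[t --> +oo] --> +oo
}.

(* Main.v *)
(* For a unit vector u the reflection z = 2<x,u>u - x satisfies |z| = |x|, and
   2<x,u><u,y> = <z,y> + <x,y>; Cauchy-Schwarz for <z,y> gives Buzano's
   inequality |<x,u><u,y>| <= (|x||y| + |<x,y>|) / 2. All the claims follow by
   applying an increasing convex function to it, with |<x,y>| <= |x||y| for the
   upper bounds. *)
Set Warnings "-notation-overridden,-notation-incompatible-prefix".
Require Import Defs.
From mathcomp Require Import ring lra.

Set Implicit Arguments.
Unset Strict Implicit.
Unset Printing Implicit Defensive.

Local Open Scope classical_set_scope.
Local Open Scope ring_scope.

Lemma rnormE (R : rcfType) (V : normedZmodType R[i]) (v : V) :
  (rnorm v)%:C%C = `|v|.
Proof. exact/RRe_real/normr_real. Qed.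

Lemma rnorm_ge0 (R : rcfType) (V : normedZmodType R[i]) (v : V) :
  0 <= rnorm v.
Proof. by rewrite -ler0c rnormE. Qed.

(* [CauchySchwarz_sqrt] is only available over a finite-dimensional
   [vectType]. *)
Lemma dot_CauchySchwarz (C : numClosedFieldType) (U : lmodType C)
    (dot : {dot U for (@Num.conj C)}) (x y : U) :
  `|dot x y| <= sqrtC (dot x x) * sqrtC (dot y y).
Proof.
have [->|y0] := eqVneq y 0.
  by rewrite !linear0r normr0 sqrtC0 mulr0.
have yy : 0 < dot y y by rewrite dnorm_gt0.
have yyr : (dot y y)^* = dot y y by rewrite geC0_conj ?ltW.
rewrite -(sqrCK (normr_ge0 _)) -sqrtCM ?nnegrE ?dnorm_ge0//.
rewrite ler_sqrtC ?nnegrE ?mulr_ge0 ?dnorm_ge0 ?exprn_ge0//.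
(* This vector is [dot y y] times the component of [x] orthogonal to [y]; the scaling avoids
   division, and its square norm is [dot y y] times the gap in Cauchy-Schwarz. *)
have := dnorm_ge0 dot (dot y y *: x - dot x y *: y).
have xyE : dot (dot y y *: x) (dot x y *: y) = dot y y * `|dot x y| ^+ 2.
  by rewrite linearZl_LR linearZr_LR/= normCK [_ * dot x y]mulrC.
rewrite dnormB xyE (dnormZ dot _ x) (dnormZ dot _ y) (ger0_norm (ltW yy)).
rewrite rmorphM/= yyr (geC0_conj (exprn_ge0 _ (normr_ge0 _))).
set d := `|_| ^+ 2.
have -> : dot y y ^+ 2 * dot x x + d * dot y y - (dot y y * d + dot y y * d)
  = dot y y * (dot x x * dot y y - d) by ring.
by rewrite pmulr_rge0// subr_ge0.
Qed.

Lemma dot_Buzano (C : numClosedFieldType) (U : lmodType C)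
    (dot : {dot U for (@Num.conj C)}) (x y u : U) : dot u u = 1 ->
  2 * `|dot x u * dot u y|
    <= sqrtC (dot x x) * sqrtC (dot y y) + `|dot x y|.
Proof.
move=> u1; set z := (2 * dot x u) *: u - x.
(* The term 4|<x,u>|^2 from [(2 * dot x u) *: u] cancels against the two conjugate cross terms, each
   2|<x,u>|^2. *)
have zz : dot z z = dot x x.
  have ux : dot u x = (dot x u)^* by rewrite hermC expr0 mul1r.
  have uxE : dot ((2 * dot x u) *: u) x = 2 * dot x u * (dot x u)^*.
    by rewrite linearZl_LR/= ux.
  rewrite dnormB uxE (dnormZ dot _ u) u1 normCK.
  by rewrite !rmorphM/= conjCK rmorph_nat; ring.
have -> : 2 * `|dot x u * dot u y| = `|dot z y + dot x y|.
  rewrite /z linearBl/= subrK linearZl_LR/= -mulrA.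
  by rewrite [RHS]normrM (ger0_norm (ler0n _ 2)).
by rewrite (le_trans (ler_normD _ _))// lerD2r -zz dot_CauchySchwarz.
Qed.

Lemma convex_function_midpoint (R : realType) (phi : R -> R) (s t : R) :
  convex_function (`[0, +oo[ : set R^o) (phi : R^o -> R^o) ->
  0 <= s -> 0 <= t -> phi ((s + t) / 2) <= 1 / 2 * (phi s + phi t).
Proof.
move=> cvx s0 t0; have h0 : 0 <= 2^-1 :> R by lra.
have h1 : 2^-1 <= 1 :> R by lra.
have sD : (s : convex_lmodType R^o) \in (`[0, +oo[%classic : set R^o).
  by rewrite inE/= in_itv/= s0.
have tD : (t : convex_lmodType R^o) \in (`[0, +oo[%classic : set R^o).
  by rewrite inE/= in_itv/= t0.
have : phi (2^-1 * s + (1 - 2^-1) * t) <= 2^-1 * phi s + (1 - 2^-1) * phi t :=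
  cvx (Itv01 h0 h1) _ _ sD tD.
have -> : 2^-1 * s + (1 - 2^-1) * t = (s + t) / 2 by lra.
lra.
Qed.

(** This is the AM-GM inequality for exp(s/2) and exp(t/2): the square of their difference is
    nonnegative. *)
Lemma expR_midpoint (R : realType) (s t : R) :
  expR ((s + t) / 2) <= 1 / 2 * expR s + 1 / 2 * expR t.
Proof.
have h (r : R) : expR r = expR (r / 2) ^+ 2.
  by rewrite expr2 -expRD -splitr.
rewrite mulrDl expRD (h s) (h t).
have := sqr_ge0 (expR (s / 2) - expR (t / 2)); lra.
Qed.

(** Midpoint convexity of [expR] is used directly: the constant in exp(t) - 1 cancels from both
    sides, so no Orlicz function has to be built for the logarithmic bounds. *)
Lemma le_ln_mean_expR (R : realType) (r s t : R) :
  r <= (s + t) / 2 -> r <= ln (1 / 2 * expR s + 1 / 2 * expR t).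
Proof.
move=> rst; rewrite -[leLHS]expRK ler_ln ?posrE ?expR_gt0//.
  by rewrite (le_trans _ (expR_midpoint s t))// ler_expR.
by have := expR_gt0 s; have := expR_gt0 t; lra.
Qed.

Lemma ln_mean_expR_le (R : realType) (s t : R) :
  t <= s -> ln (1 / 2 * expR s + 1 / 2 * expR t) <= s.
Proof.
rewrite -ler_expR => ts; rewrite -[leRHS]expRK ler_ln ?posrE ?expR_gt0//.
  by lra.
by have := expR_gt0 s; have := expR_gt0 t; lra.
Qed.

(* A complex Hilbert space is a complete normed space over R[i] whose norm is
   the one induced by the inner product [dot], linear in its first argument. *)
Theorem proposition2p7 (R : realType) (H : completeNormedModType R[i])
    (dot : {dot H for (@Num.conj R[i])})
    (norm_dot : forall v : H, `|v| = sqrtC (dot v v))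
    (x y u : H) (norm_u : rnorm u = 1) :
  (forall phi : R -> R, orlicz_function phi ->
     phi (rnorm (dot x u * dot u y))
       <= 1 / 2 * (phi (rnorm x * rnorm y) + phi (rnorm (dot x y)))) /\
  (rnorm (dot x u * dot u y)
       <= ln (1 / 2 * expR (rnorm x * rnorm y)
              + 1 / 2 * expR (rnorm (dot x y))) /\
   ln (1 / 2 * expR (rnorm x * rnorm y)
       + 1 / 2 * expR (rnorm (dot x y))) <= rnorm x * rnorm y) /\
  (rnorm (dot x u * dot u y)
       <= Num.sqrt (ln (1 / 2 * expR (rnorm x ^+ 2 * rnorm y ^+ 2)
                        + 1 / 2 * expR (rnorm (dot x y) ^+ 2))) /\
   Num.sqrt (ln (1 / 2 * expR (rnorm x ^+ 2 * rnorm y ^+ 2)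
                 + 1 / 2 * expR (rnorm (dot x y) ^+ 2))) <= rnorm x * rnorm y).
Proof.
have re1 : dot u u = 1.
  by rewrite -[LHS]sqrtCK -norm_dot -rnormE norm_u expr1n.
have buz : rnorm (dot x u * dot u y)
    <= (rnorm x * rnorm y + rnorm (dot x y)) / 2.
  (* Each term of this inequality in [R[i]] is the image of a real number, so it descends to [R]
     through [lecR]. *)
  have := dot_Buzano x y re1.
  rewrite -!norm_dot -!rnormE -(rmorph_nat (real_complex R)) -!rmorphM.
  rewrite -rmorphD lecR; lra.
have cs : rnorm (dot x y) <= rnorm x * rnorm y.
  by have := dot_CauchySchwarz dot x y; rewrite -!norm_dot -!rnormE -rmorphM lecR.
have a0 := rnorm_ge0 (dot x u * dot u y).
have b0 : 0 <= rnorm x * rnorm y by rewrite mulr_ge0 ?rnorm_ge0.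
have c0 := rnorm_ge0 (dot x y).
split; [|split; split].
- move=> phi phiO; rewrite (le_trans _ (convex_function_midpoint _ b0 c0))//.
    by apply: (orlicz_increasing phiO); rewrite ?in_itv/= ?andbT// divr_ge0 ?addr_ge0.
  exact: orlicz_convex.
- exact: le_ln_mean_expR.
- exact: ln_mean_expR_le.
- rewrite -[leLHS]ger0_norm// -sqrtr_sqr ler_wsqrtr// le_ln_mean_expR//.
  (* Squaring [buz] and using convexity of the square: a <= (b + c)/2 with a, b, c >= 0 gives a^2 <=
     (b^2 + c^2)/2. *)
  by rewrite -exprMn; nra.
- rewrite -[leRHS]ger0_norm// -sqrtr_sqr ler_wsqrtr// -exprMn.
  by rewrite ln_mean_expR_le// lerXn2r.
Qed.
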